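(* Let $\mathfrak{g}$ be a (finite-dimensional) real nilpotent Lie algebra. Then the set of nice bases of $\mathfrak{g}$, taken up to equivalence, is at most countable.
   Context: A nice basis of a finite-dimensional real Lie algebra $\mathfrak{g}$ is a basis $\{e_1,\dots,e_n\}$, with dual basis $\{e^1,\dots,e^n\}$, such that each $[e_i,e_j]$ is a (possibly zero) scalar multiple of a single basis element $e_k$ depending on $i,j$, and each interior product $e_i\lrcorner\, de^j$ is a (possibly zero) scalar multiple of a single $e^h$ depending on $i,j$; here $d\colon\mathfrak{g}^*\to\Lambda^2\mathfrak{g}^*$ is the Chevalley–Eilenberg differential. Two nice bases $\mathcal{B},\mathcal{B}'$ of $\mathfrak{g}$ are equivalent if there is a Lie algebra automorphism of $\mathfrak{g}$ mapping each element of $\mathcal{B}$ to a nonzero multiple of an element of $\mathcal{B}'$. *)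

(* Defs.v *)
From HB Require Import structures.
From mathcomp Require Import all_boot all_order all_algebra.
From mathcomp Require Import all_classical all_reals.

Set Implicit Arguments.
Unset Strict Implicit.
Unset Printing Implicit Defensive.

Import GRing.Theory.

Local Open Scope ring_scope.

HB.mixin Record isLieAlgebra (K : fieldType) g of Vector K g := {
  lie : g -> g -> g;
  lie_linearl : forall y, linear (lie^~ y);
  lie_linearr : forall x, linear (lie x);
  liexx : forall x, lie x x = 0;
  lie_jacobi : forall x y z,
    lie x (lie y z) + lie y (lie z x) + lie z (lie x y) = 0
}.

(* Finite dimensionality comes from vectType. *)
#[short(type="lieAlgType")]
HB.structure Definition LieAlgebra (K : fieldType) :=
  {g of isLieAlgebra K g & Vector K g}.

HB.instance Definition _ (K : fieldType) (g : lieAlgType K) :=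
  bilinear_isBilinear.Build K g g g *:%R *:%R (@lie K g)
    (@lie_linearl K g, @lie_linearr K g).

Section Nilpotency.

Variables (K : fieldType) (g : lieAlgType K).

(* The span of all [x, y] with x in U and y in W. By bilinearity, bases of U  *)
(* and W suffice to generate it: see memv_lie_space and lie_space_subP.       *)
Definition lie_space (U W : {vspace g}) : {vspace g} :=
  <<[seq lie x y | x <- vbasis U, y <- vbasis W]>>%VS.

Lemma memv_lie_space (U W : {vspace g}) x y :
  x \in U -> y \in W -> lie x y \in lie_space U W.
Proof.
move=> /coord_vbasis -> /coord_vbasis ->.
rewrite linear_sumlz; apply: memv_suml => i _.
rewrite linear_sumr; apply: memv_suml => j _.
rewrite linearZl_LR linearZr_LR; do 2![apply: memvZ].
apply/memv_span/allpairs_f; apply/mem_nth; by rewrite size_tuple.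
Qed.

Lemma lie_space_subP (U W X : {vspace g}) :
  reflect (forall x y, x \in U -> y \in W -> lie x y \in X)
          (lie_space U W <= X)%VS.
Proof.
apply: (iffP idP) => [/subvP sX x y Ux Wy | UWX].
  exact/sX/memv_lie_space.
apply/span_subvP => _ /allpairsP[[x y] /= [Ux Wy ->]].
by apply: UWX; apply: vbasis_mem.
Qed.

Definition lower_central_series (n : nat) : {vspace g} :=
  iter n (lie_space fullv) fullv.

Definition nilpotent_lie : Prop := exists n, lower_central_series n = 0%VS.

End Nilpotency.

Arguments nilpotent_lie {K} g.

(* Elements of \Lambda^2 g^*, seen as alternating bilinear forms on g.        *)
Record alt2_form (K : fieldType) (g : lieAlgType K) := Alt2Form {
  alt2_biscalar :> {biscalar g};
  alt2xx : forall x, alt2_biscalar x x = 0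
}.

Section NiceBases.

Variables (K : fieldType) (g : lieAlgType K).

Definition ce_diff_fun (alpha : {scalar g}) (x y : g) : K :=
  - alpha (lie x y).

Fact ce_diff_bilinear alpha : bilinear_for *%R *%R (ce_diff_fun alpha).
Proof.
split=> [y a u v | x a u v]; rewrite /ce_diff_fun.
  by rewrite lie_linearl linearP /= opprD mulrN.
by rewrite lie_linearr linearP /= opprD mulrN.
Qed.

HB.instance Definition _ alpha :=
  bilinear_isBilinear.Build K g g K *%R *%R (ce_diff_fun alpha)
    (ce_diff_bilinear alpha).

Fact ce_diffxx alpha x : ce_diff_fun alpha x x = 0.
Proof. by rewrite /ce_diff_fun liexx linear0 oppr0. Qed.

(* The Chevalley-Eilenberg differential d : g^* -> \Lambda^2 g^*.             *)
Definition ce_diff (alpha : {scalar g}) : alt2_form g :=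
  @Alt2Form K g (ce_diff_fun alpha) (ce_diffxx alpha).

Definition interior_product (x : g) (w : alt2_form g) : {scalar g} := w x.

(* A basis is an enumeration e_0, ..., e_(n-1) with n = dim g, and            *)
(* [coord e j : {scalar g}] is the element e^j of the dual basis.             *)
Definition nice_basis (e : (\dim {:g}).-tuple g) : Prop :=
  [/\ basis_of {:g}%VS e,
      forall i j : 'I_(\dim {:g}), exists k : 'I_(\dim {:g}), exists c : K,
        lie e`_i e`_j = c *: e`_k
    & forall i j : 'I_(\dim {:g}), exists h : 'I_(\dim {:g}), exists c : K,
        interior_product e`_i (ce_diff (coord e j))
          =1 (fun y => c * coord e h y)].

Definition lie_automorphism (f : 'End(g)) : Prop :=
  bijective f /\ forall x y, f (lie x y) = lie (f x) (f y).

(* This depends only on the underlying sets of basis vectors; in particular   *)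
(* two enumerations of the same basis are equivalent.                         *)
Definition nice_equiv (e e' : (\dim {:g}).-tuple g) : Prop :=
  exists2 f : 'End(g), lie_automorphism f
    & forall x, x \in e -> exists2 y, y \in e' &
        exists2 c : K, c != 0 & f x = c *: y.

Definition nice_class (e : (\dim {:g}).-tuple g) :
    set ((\dim {:g}).-tuple g) :=
  [set e' | nice_basis e' /\ nice_equiv e e']%classic.

End NiceBases.

Arguments nice_basis {K} g e.

(* Main.v *)
(* Rescaling a nice basis by positive factors normalizes to 1 or -1 those      *)
(* nonzero structure constants c_ijk whose weights (a == i) + (a == j) -       *)
(* (a == k) form a maximal independent set. The point is that the other        *)
(* structure constants then are algebraic over the countable subring A         *)
(* generated by the structure constants of one fixed basis b of g. If not,     *)
(* some derivation D of R kills A but not all of them. Applied to coordinates  *)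
(* in b, D induces a derivation (semilinear over D) of the bracket, and        *)
(* niceness forces D c_ijk = c_ijk (z_i + z_j - z_k), where z is the diagonal  *)
(* of that derivation. So the weights of the normalized constants vanish on z, *)
(* hence so do all the weights, and D kills every c_ijk. Thus, up to           *)
(* equivalence, the structure constants lie in a countable set, and they       *)
(* determine the basis up to an automorphism.                                  *)

(* Structure constants determine a basis up to automorphism ([nice_equiv_structure_constant]). So it
   suffices to rescale every nice basis to one whose constants lie in a fixed countable set
   ([countable_nice_constants]).

   That set consists of the reals algebraic over a countable ring, and membership is tested with
   derivations: a real killed by every derivation of R that vanishes on the ring is algebraic over
   it ([derivation_separates]). The criterion rests on [derivation_extension], where a partial
   derivation is encoded by its graph, a subring of the dual numbers.

   Niceness enters through [derivation_structure_constant]: the logarithmic derivative of a nonzero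
   c_ijk is the weight of (i, j, k) paired with a vector z depending only on D and the basis.
   [nice_basis_normalize] makes the constants ±1 on weights spanning all the relevant ones, by one
   rescaling that serves every D at once. *)
Require Import Defs.
From HB Require Import structures.
From mathcomp Require Import all_boot all_order all_algebra.
From mathcomp Require Import all_classical all_reals.
From mathcomp Require Import sequences exp.
From mathcomp Require Import ring zify.

Set Implicit Arguments.
Unset Strict Implicit.
Unset Printing Implicit Defensive.

Import Order.TTheory GRing.Theory Num.Theory.

Local Open Scope classical_set_scope.
Local Open Scope ring_scope.

(** * Extending derivations *)

(* The pair (a, a') stands for a + a' eps with eps ^+ 2 = 0. *)
Definition dual (K : Type) : Type := (K * K)%type.

HB.instance Definition _ (K : zmodType) := GRing.Zmodule.on (dual K).

Section DualRing.
Variable K : comNzRingType.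

Definition dual_one : dual K := (1, 0).
Definition dual_mul (u v : dual K) : dual K := (u.1 * v.1, u.1 * v.2 + u.2 * v.1).

Fact dual_mulA : associative dual_mul.
Proof.
move=> u v w; congr pair; first by rewrite /= mulrA.
by rewrite /= mulrDr mulrDl !mulrA addrA.
Qed.

Fact dual_mulC : commutative dual_mul.
Proof.
move=> u v; congr pair; first by rewrite /= mulrC.
by rewrite /= addrC [u.2 * _]mulrC [u.1 * _]mulrC.
Qed.

Fact dual_mul1 : left_id dual_one dual_mul.
Proof. by case=> a b; rewrite /dual_mul /= !mul1r mul0r addr0. Qed.

Fact dual_mulDl : left_distributive dual_mul +%R.
Proof.
move=> u v w; congr pair; first by rewrite /= mulrDl.
by rewrite /= !mulrDl addrACA.
Qed.

Fact dual_one_neq0 : dual_one != 0.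
Proof. by apply/eqP => -[/eqP]; rewrite oner_eq0. Qed.

HB.instance Definition _ := GRing.Zmodule_isComNzRing.Build (dual K)
  dual_mulA dual_mulC dual_mul1 dual_mulDl dual_one_neq0.

Definition dual_re (u : dual K) : K := u.1.

Fact dual_re_zmod : zmod_morphism dual_re. Proof. by []. Qed.
Fact dual_re_monoid : monoid_morphism dual_re. Proof. by []. Qed.
HB.instance Definition _ := GRing.isZmodMorphism.Build _ _ dual_re dual_re_zmod.
HB.instance Definition _ := GRing.isMonoidMorphism.Build _ _ dual_re dual_re_monoid.

(** First-order Taylor formula. Since eps ^+ 2 = 0, only the real parts of the coefficients of the
    derivative meet the term v eps. *)
Lemma dual_horner (p : {poly dual K}) (y v : K) :
  p.[(y, v) : dual K] =
    p.[(y, 0) : dual K] + (0, (map_poly dual_re p^`()).[y] * v).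
Proof.
elim/poly_ind: p => [|p c IHp].
  by rewrite deriv0 rmorph0 !horner0 mul0r [RHS]addr0.
rewrite derivMXaddC !hornerMXaddC IHp rmorphD rmorphM /= map_polyX hornerD hornerMX.
rewrite (horner_map dual_re p ((y, 0) : dual K)) /dual_re /=.
by case: p.[_] => a b; congr pair; rewrite /=; ring.
Qed.

End DualRing.

(** * Derivations as subrings of the dual numbers *)

Section DerivationGraph.
Variable K : numFieldType.
Implicit Types (S : set (dual K)) (p q : {poly dual K}) (z : dual K).

(* The graph of a derivation into K from a subring of K. *)
Definition derivation_graph S : Prop :=
  [/\ S 1, forall u v, S u -> S v -> S (u - v),
      forall u v, S u -> S v -> S (u * v)
    & forall w, S (0, w) -> w = 0].

Definition poly_over S p : Prop := forall i, S p`_i.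

Definition adjoin S z : set (dual K) := [set p.[z] | p in poly_over S].

Section Closure.
Variable S : set (dual K).
Hypothesis grS : derivation_graph S.

Lemma graph0 : S 0.
Proof. by case: grS => S1 SB _ _; rewrite -(subrr 1); apply: SB. Qed.

Lemma graphN u : S u -> S (- u).
Proof. by case: grS => _ SB _ _ Su; rewrite -sub0r; apply: SB => //; apply: graph0. Qed.

Lemma graphD u v : S u -> S v -> S (u + v).
Proof. by case: grS => _ SB _ _ Su Sv; rewrite -[v]opprK; apply/SB/graphN. Qed.

Lemma graphMn u n : S u -> S (u *+ n).
Proof.
by move=> Su; elim: n => [|n IHn]; rewrite ?mulr0n ?mulrS; [apply: graph0 | apply: graphD].
Qed.

Lemma poly_overC u : S u -> poly_over S u%:P.
Proof. by move=> Su i; rewrite coefC; case: ifP => // _; apply: graph0. Qed.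

Lemma poly_overX : poly_over S 'X.
Proof.
case: grS => S1 _ _ _ i; rewrite coefX.
by case: (i == 1)%N => //; apply: graph0.
Qed.

Lemma poly_overB p q : poly_over S p -> poly_over S q -> poly_over S (p - q).
Proof. by case: grS => _ SB _ _ Sp Sq i; rewrite coefB; apply: SB. Qed.

Lemma poly_overM p q : poly_over S p -> poly_over S q -> poly_over S (p * q).
Proof.
case: grS => _ _ SM _ Sp Sq i; rewrite coefM; elim/big_ind: _ => [|u v|j _].
- exact: graph0.
- exact: graphD.
- exact: SM.
Qed.

Lemma poly_overXn n : poly_over S 'X^n.
Proof.
elim: n => [|n IHn]; first by apply: poly_overC; case: grS.
by rewrite exprS; apply: poly_overM => //; apply: poly_overX.
Qed.

Lemma poly_over_deriv p : poly_over S p -> poly_over S p^`().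
Proof. by move=> Sp i; rewrite coef_deriv; apply: graphMn. Qed.

Lemma graph_re_eq0 u : S u -> dual_re u = 0 -> u = 0.
Proof.
case: grS => _ _ _ Sw; case: u => a b /= Sab a0.
by rewrite /dual_re /= in a0; subst a; rewrite (Sw _ Sab).
Qed.

(** The real part is injective on S, so it cannot kill a leading coefficient. *)
Lemma size_poly_over p : poly_over S p -> size (map_poly (@dual_re K) p) = size p.
Proof.
move=> Sp; have [->|p0] := eqVneq p 0; first by rewrite rmorph0 !size_poly0.
apply: size_map_poly_id0; apply: contraNneq p0 => /(graph_re_eq0 (Sp _))/eqP.
by rewrite -/(lead_coef p) lead_coef_eq0.
Qed.

Lemma sub_adjoin z : S `<=` adjoin S z.
Proof. by move=> u Su; exists u%:P; [apply: poly_overC | rewrite hornerC]. Qed.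

Lemma mem_adjoin z : adjoin S z z.
Proof. by exists 'X; [apply: poly_overX | rewrite hornerX]. Qed.

Lemma derivation_graph_adjoin z :
    (forall q, poly_over S q -> dual_re q.[z] = 0 -> q.[z] = 0) ->
  derivation_graph (adjoin S z).
Proof.
move=> Sz; split.
- by apply: sub_adjoin; case: grS.
- move=> _ _ [p Sp <-] [q Sq <-].
  by exists (p - q); [apply: poly_overB | rewrite hornerD hornerN].
- move=> _ _ [p Sp <-] [q Sq <-].
  by exists (p * q); [apply: poly_overM | rewrite hornerM].
- by move=> w [q Sq qz]; have := Sz q Sq; rewrite qz => /(_ erefl) [].
Qed.

Lemma re_horner q (y v : K) :
  dual_re q.[(y, v) : dual K] = (map_poly (@dual_re K) q).[y].
Proof. by rewrite (horner_map (@dual_re K) q ((y, v) : dual K)). Qed.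

(** With no algebraic relation on y to differentiate, any v can be the value of the derivation at
    y. *)
Lemma adjoin_transcendental (y v : K) :
    (forall q, poly_over S q -> (map_poly (@dual_re K) q).[y] = 0 -> q = 0) ->
  derivation_graph (adjoin S (y, v)).
Proof.
move=> tr; apply: derivation_graph_adjoin => q Sq.
by rewrite re_horner => /(tr q Sq) ->; rewrite horner0.
Qed.

(* The value v at an algebraic y is forced by differentiating the minimal   *)
(* equation of y; minimality makes it separable, since K has char. 0, and   *)
(* pseudo-division shows that v is compatible with every other equation.    *)
Lemma adjoin_exists (y : K) : exists v, derivation_graph (adjoin S (y, v)).
Proof.
pose eqn n := `[< exists q, [/\ poly_over S q, q != 0, size q = n
                 & (map_poly (@dual_re K) q).[y] = 0] >].
case: (pselect (exists n, eqn n)) => [ex | nex]; last first.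
  exists 0; apply: adjoin_transcendental => q Sq qy.
  by apply/eqP/negPn/negP => q0; apply: nex; exists (size q); apply/asboolP; exists q.
case: (ex_minnP ex) => _ /asboolP[p [Sp p0 <- py]] min_p.
have min q : poly_over S q -> (size q < size p)%N ->
    (map_poly (@dual_re K) q).[y] = 0 -> q = 0.
  move=> Sq ltq qy; apply/eqP; apply: contraLR ltq => q0; rewrite -leqNgt.
  by apply: min_p; apply/asboolP; exists q.
have dp_neq0 : (map_poly (@dual_re K) p^`()).[y] != 0.
  apply/eqP => dpy; have dp0 := min _ (poly_over_deriv Sp) (lt_size_deriv p0) dpy.
  have sp : (size p <= 1)%N.
    apply/leq_sizeP => [[|j]] // _; apply: graph_re_eq0 => //.
    have : dual_re p^`()`_j = 0 by rewrite dp0 coef0.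
    by rewrite coef_deriv raddfMn => /eqP; rewrite mulrn_eq0 /= => /eqP.
  move: py p0; rewrite (size1_polyC sp) map_polyC hornerC /= polyC_eq0 => p0 /eqP; apply.
  exact: graph_re_eq0.
pose v := - (p.[(y, 0) : dual K]).2 / (map_poly (@dual_re K) p^`()).[y].
have pz : p.[(y, v) : dual K] = 0.
  have re0 : (p.[(y, 0) : dual K]).1 = 0 by rewrite -[LHS]/(dual_re _) re_horner.
  rewrite dual_horner /v; case: p.[_] re0 => a b /= ->; congr pair; rewrite /= ?addr0 //.
  by rewrite mulrC divfK // subrr.
exists v; apply: derivation_graph_adjoin => q.
have [n] := ubnP (size q); elim: n q => // n IHn q ltn Sq qz.
have [ltqp | lepq] := ltnP (size q) (size p).
  by rewrite [q]min ?horner0 // -(re_horner q y v).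
have [->|q0] := eqVneq q 0; first by rewrite horner0.
pose r := (lead_coef p)%:P * q - (lead_coef q)%:P * 'X^(size q - size p) * p.
have rz : r.[(y, v) : dual K] = lead_coef p * q.[(y, v) : dual K].
  by rewrite !hornerE pz mulr0 subr0.
have Sr : poly_over S r.
  apply: poly_overB; first by apply: poly_overM => //; apply/poly_overC/Sp.
  by do 2![apply: poly_overM => //]; [apply/poly_overC/Sq | apply: poly_overXn].
have sq : (size q = (size q).-1.+1)%N by rewrite prednK // size_poly_gt0.
have ltr : (size r < size q)%N.
  rewrite sq ltnS; apply/leq_sizeP => j; rewrite leq_eqVlt => /predU1P[<-|ltj].
    rewrite coefB coefCM -mulrA coefCM coefXnM ltnNge.
    have -> : (size q - size p <= (size q).-1)%N by have := size_poly_gt0 p; lia.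
    have -> : ((size q).-1 - (size q - size p) = (size p).-1)%N.
      by have := size_poly_gt0 p; rewrite p0; lia.
    by rewrite /= -!/(lead_coef _) mulrC subrr.
  have leqj : (size q <= j)%N by rewrite sq.
  rewrite coefB coefCM -mulrA coefCM coefXnM (nth_default 0 leqj) mulr0.
  case: ifP => _; first by rewrite mulr0 subr0.
  by rewrite nth_default ?mulr0 ?subr0 // -{1}(subKn lepq) leq_sub2r.
(* The leading coefficient of p need not be invertible in S, but its nonzero real part can be
   cancelled from the eps component of r at (y, v). *)
have lp_neq0 : dual_re (lead_coef p) != 0.
  by apply: contraNneq p0 => /(graph_re_eq0 (Sp _))/eqP; rewrite lead_coef_eq0.
have : r.[(y, v) : dual K] = 0.
  by apply: IHn; [lia | | rewrite rz rmorphM /= qz mulr0].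
rewrite rz; case: q.[_] qz => a b /= a0; rewrite /dual_re /= in a0; subst a.
by move=> [_ /eqP]; rewrite mulr0 addr0 mulf_eq0 (negbTE lp_neq0) /= => /eqP ->.
Qed.

End Closure.

Lemma derivation_graph_bigcup (F : set (set (dual K))) :
    F !=set0 -> (forall S, F S -> derivation_graph S) -> total_on F subset ->
  derivation_graph (\bigcup_(S in F) S).
Proof.
move=> [S0 FS0] grF tot.
have common u v : (\bigcup_(S in F) S) u -> (\bigcup_(S in F) S) v ->
    exists2 S, F S & S u /\ S v.
  move=> [S FS Su] [T FT Tv].
  by case: (tot S T FS FT) => sub; [exists T | exists S] => //; split => //; apply: sub.
split.
- by exists S0 => //; case: (grF _ FS0).
- move=> u v Uu Uv; have [S FS [Su Sv]] := common u v Uu Uv.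
  by exists S => //; case: (grF _ FS) => _ SB _ _; apply: SB.
- move=> u v Uu Uv; have [S FS [Su Sv]] := common u v Uu Uv.
  by exists S => //; case: (grF _ FS) => _ _ SM _; apply: SM.
- by move=> w [S FS]; case: (grF _ FS) => _ _ _; apply.
Qed.

(** By Zorn there is a maximal graph containing S0. Were it not defined at some y, [adjoin_exists]
    would enlarge it. *)
Lemma derivation_extension (S0 : set (dual K)) : derivation_graph S0 ->
  exists D : K -> K, [/\ {morph D : x y / x + y},
    forall x y, D (x * y) = x * D y + D x * y
    & forall u, S0 u -> D u.1 = u.2].
Proof.
move=> grS0.
pose P S := S = set0 \/ S0 `<=` S /\ derivation_graph S.
have [F FP tot|S [PS maxS]] := @Zorn_bigcup _ P.
  pose F' := [set S | F S /\ (S0 `<=` S /\ derivation_graph S)].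
  have FF' : \bigcup_(S in F) S = \bigcup_(S in F') S.
    apply/seteqP; split => u [S]; last by move=> [FS _] Su; exists S.
    by move=> FS Su; case: (FP S FS) Su => [->|good] // Su; exists S.
  rewrite FF'; case: (pselect (F' !=set0)) => [[S F'S]|F'0]; last first.
    by left; apply/seteqP; split => u // [S F'S Su]; apply: F'0; exists S.
  right; split; first by move=> u S0u; exists S => //; case: F'S => _ [sub _]; apply: sub.
  apply: derivation_graph_bigcup; [by exists S | by move=> T [_ []] |].
  by move=> T U [FT _] [FU _]; apply: tot.
have max T : derivation_graph T -> S0 `<=` T -> S `<=` T -> T `<=` S.
  move=> grT S0T ST; apply: contrapT => TS.
  by apply: (maxS T) => //; right.
have [subS0 grS] : S0 `<=` S /\ derivation_graph S.
  case: PS => // S_0; have := max S0 grS0; rewrite S_0 => /(_ (fun _ x => x) (sub0set _)).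
  by case: grS0 => S01 _ _ _ /(_ _ S01).
have total y : exists v, S (y, v).
  have [v grv] := adjoin_exists grS y; exists v.
  apply: (max _ grv); [| exact: sub_adjoin | exact: mem_adjoin].
  by move=> u /subS0 /(sub_adjoin grS); apply.
have [D SD] := choice total.
(* Two values at the same point differ by some (0, w) in S, which forces w = 0. *)
have Duniq u : S u -> D u.1 = u.2.
  case: u => a b Sab /=; apply/eqP; rewrite -subr_eq0; apply/eqP.
  case: grS => _ SB _ Sw; apply: Sw.
  by have := SB _ _ (SD a) Sab; rewrite /GRing.add /= /GRing.opp /= /add_pair /= subrr.
exists D; split => [x y|x y|u /subS0 /Duniq //].
  exact: (Duniq _ (graphD grS (SD x) (SD y))).
case: grS => _ _ SM _.
exact: (Duniq _ (SM _ _ (SD x) (SD y))).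
Qed.

End DerivationGraph.

(** * Algebraic elements, derivations and countability *)

Definition algebraic_values (A : comNzRingType) (K : fieldType) (phi : {rmorphism A -> K}) :
    set K :=
  [set x | exists2 p : {poly A}, map_poly phi p != 0 & root (map_poly phi p) x].

(** If x were transcendental over the image of [phi], the zero derivation on that image would extend
    to one sending x to 1. *)
Lemma derivation_separates (A : comNzRingType) (K : numFieldType)
    (phi : {rmorphism A -> K}) (x : K) :
    (forall D : K -> K, {morph D : a b / a + b} ->
       (forall a b, D (a * b) = a * D b + D a * b) ->
       (forall a, D (phi a) = 0) -> D x = 0) ->
  algebraic_values phi x.
Proof.
move=> Dx; apply: contrapT => nalg.
pose A0 : set (dual K) := range (fun a => (phi a, 0) : dual K).
have grA0 : derivation_graph A0.
  split; first by exists 1; rewrite ?rmorph1.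
  - move=> _ _ [a _ <-] [b _ <-]; exists (a - b) => //.
    by rewrite rmorphB; congr pair; rewrite /= subr0.
  - move=> _ _ [a _ <-] [b _ <-]; exists (a * b) => //.
    by rewrite rmorphM; congr pair; rewrite /= mulr0 mul0r addr0.
  - by move=> w [a _ [_ <-]].
have [|D [DD DM Dext]] := derivation_extension (@adjoin_transcendental _ _ grA0 x 1 _).
  move=> q A0q qx; apply/eqP/negPn/negP => q0; apply: nalg.
  have /choice[f qf] i : exists a, (phi a, 0) = q`_i by have [a _ <-] := A0q i; exists a.
  have qE : map_poly phi (\poly_(i < size q) f i) = map_poly (@dual_re K) q.
    apply/polyP => i; rewrite !coef_map coef_poly.
    case: ltnP => [_|leqi]; last by rewrite raddf0 (nth_default 0 leqi) raddf0.
    by rewrite -qf.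
  exists (\poly_(i < size q) f i); last by rewrite qE; apply/eqP.
  by rewrite qE -size_poly_eq0 (size_poly_over grA0) // size_poly_eq0.
have Dphi a : D (phi a) = 0.
  by apply: (Dext (phi a, 0)); apply: sub_adjoin => //; exists a.
have := Dext _ (mem_adjoin grA0 (x, 1)).
by rewrite /= (Dx D DD DM Dphi) => /eqP; rewrite eq_sym oner_eq0.
Qed.

Lemma countable_algebraic_values (A : countComNzRingType) (K : fieldType)
    (phi : {rmorphism A -> K}) :
  countable (algebraic_values phi).
Proof.
pose F (p : {poly A}) : set K := [set x | map_poly phi p != 0 /\ root (map_poly phi p) x].
have -> : algebraic_values phi = \bigcup_(p in setT) F p.
  by apply/seteqP; split => x [p p0 px]; exists p => //; case: px.
apply: bigcup_countable; first exact: countableP.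
move=> p _; apply: finite_set_countable; apply: contrapT => infF.
have [B sBF leB] := infinite_set_fset (size (map_poly phi p)) infF.
have Fx x : x \in finmap.enum_fset B -> F p x by move=> xB; apply: sBF.
move: leB; rewrite leqNgt => /negP; apply.
have p0 : map_poly phi p != 0.
  case: (pselect (F p !=set0)) => [[x []] //|F0]; case: infF.
  suff -> : F p = set0 by [].
  by apply/seteqP; split => x // Fpx; apply: F0; exists x.
apply: max_poly_roots => //; last exact: finmap.fset_uniq.
by apply/allP => x /Fx[].
Qed.

(** A is an iterated polynomial ring over the integers, one indeterminate per element of s. The map
    [phi] need not be injective: only its image matters. *)
Lemma countable_subring_containing (K : comNzRingType) (s : seq K) :
  exists (A : countComNzRingType) (phi : {rmorphism A -> K}),
    forall x, x \in s -> exists a, phi a = x.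
Proof.
elim: s => [|x s [A [phi IHs]]]; first by exists int, (intmul 1).
have cx : commr_rmorph phi x by move=> a; apply: mulrC.
exists {poly A}, (horner_morph cx) => y; rewrite inE => /predU1P[->|/IHs[a <-]].
  by exists 'X; apply: (horner_morphX cx).
by exists a%:P; apply: (horner_morphC cx).
Qed.

(** * Nice bases *)

Section StructureConstants.
Variables (K : fieldType) (g : lieAlgType K).
Local Notation n := (\dim {:g}).
Implicit Types (e : n.-tuple g) (x y : g) (i j k : 'I_n).

Definition structure_constant e i j k : K := coord e k (lie e`_i e`_j).

Lemma lieC x y : lie x y = - lie y x.
Proof.
apply/eqP; rewrite -addr_eq0; apply/eqP.
by have := liexx (x + y); rewrite linearDl !linearDr /= !liexx add0r addr0.
Qed.

Lemma coord_basisE e x : basis_of {:g} e -> x = \sum_i coord e i x *: e`_i.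
Proof. by move=> be; apply: coord_basis (memvf x). Qed.

Lemma coord_inj e x y : basis_of {:g} e -> (forall i, coord e i x = coord e i y) -> x = y.
Proof.
move=> be exy; rewrite (coord_basisE x be) (coord_basisE y be).
by apply: eq_bigr => i _; rewrite exy.
Qed.

Lemma basis_bilinear_eq0 e (B : g -> g -> g) : basis_of {:g} e ->
    (forall y, linear (B^~ y)) -> (forall x, linear (B x)) ->
    (forall i j, B e`_i e`_j = 0) ->
  forall x y, B x y = 0.
Proof.
move=> be Bl Br Be x y.
pose F : {bilinear g -> g -> g} :=
  HB.pack B (bilinear_isBilinear.Build K g g g *:%R *:%R B (Bl, Br)).
rewrite -[B]/(F : g -> g -> g) (coord_basisE x be) (coord_basisE y be).
rewrite linear_sumlz big1 // => i _; rewrite linear_sumr big1 // => j _.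
by rewrite linearZl_LR linearZr_LR /= Be !scaler0.
Qed.

Lemma mem_basis_nth e i : e`_i \in (e : seq g).
Proof. by apply: mem_nth; rewrite size_tuple. Qed.

Lemma nice_equivP e e' : nice_equiv e e' <->
  exists2 f : 'End(g), lie_automorphism f &
    forall i, exists (j : 'I_n) (c : K), c != 0 /\ f e`_i = c *: e'`_j.
Proof.
split=> -[f autf fe]; exists f => //.
  move=> i; have [_ /tnthP[j ->] [c c0 fei]] := fe _ (mem_basis_nth e i).
  by exists j, c; rewrite -(tnth_nth 0 e').
move=> _ /tnthP[i ->]; have [j [c [c0 fei]]] := fe i.
by exists e'`_j; [apply: mem_basis_nth | exists c; rewrite // (tnth_nth 0)].
Qed.

Lemma bijective_lker0 (f : 'End(g)) : bijective f -> lker f == 0%VS.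
Proof. by move=> /bij_inj/lker0P. Qed.

Lemma lie_automorphism_inv (f : 'End(g)) : lie_automorphism f -> lie_automorphism (f^-1)%VF.
Proof.
move=> [bf lf]; have kf := bijective_lker0 bf; split.
  by exists f; [apply: lker0_lfunVK | apply: lker0_lfunK].
move=> x y; rewrite -{1}[x](lker0_lfunVK kf) -{1}[y](lker0_lfunVK kf).
by rewrite -lf lker0_lfunK.
Qed.

Lemma lie_automorphism_comp (f h : 'End(g)) :
  lie_automorphism f -> lie_automorphism h -> lie_automorphism (h \o f)%VF.
Proof.
move=> [bf lf] [bh lh]; split; last by move=> x y; rewrite !comp_lfunE lf lh.
by apply: (eq_bij (bij_comp bh bf)) => x; rewrite comp_lfunE.
Qed.

Lemma nice_equiv_trans e1 e2 e3 :
  nice_equiv e1 e2 -> nice_equiv e2 e3 -> nice_equiv e1 e3.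
Proof.
move=> [f autf fe] [h auth he]; exists (h \o f)%VF; first exact: lie_automorphism_comp.
move=> x /fe[y /he[z ze3 [d d0 hy]] [c c0 fx]].
by exists z => //; exists (c * d); rewrite ?mulf_neq0 // comp_lfunE fx linearZ /= hy scalerA.
Qed.

Lemma nice_equiv_sym e e' : basis_of {:g} e -> nice_equiv e e' -> nice_equiv e' e.
Proof.
move=> be /nice_equivP[f autf fe]; apply/nice_equivP.
have kf : lker f == 0%VS by apply: bijective_lker0; case: autf.
have /choice[s /choice[c cs]] := fe.
(* If e_i and e_j had proportional images, a nontrivial combination of them would lie in the kernel
   of f. Injectivity then makes s a permutation of the finite index set. *)
have s_inj : injective s.
  move=> i j sij; apply/eqP; apply: contraT => nij.
  have fd : f (c j *: e`_i - c i *: e`_j) = 0.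
    rewrite linearB !linearZ /= (cs i).2 (cs j).2 sij.
    by rewrite scalerN !scalerA mulrC subrr.
  have /(congr1 (coord e i)) : c j *: e`_i - c i *: e`_j = 0.
    by apply: (lker0P kf); rewrite fd linear0.
  rewrite linearB !linearZ /= !coord_free ?(basis_free be) // eqxx eq_sym (negbTE nij).
  by rewrite mulr1 mulr0 subr0 linear0 => /eqP; rewrite (negbTE (cs j).1).
have [s' _ ss'] := injF_bij s_inj.
exists (f^-1)%VF; first exact: lie_automorphism_inv.
move=> j; exists (s' j), (c (s' j))^-1; split; first by rewrite invr_eq0; case: (cs (s' j)).
apply: (lker0P kf); rewrite lker0_lfunVK // linearZ /= (cs (s' j)).2 ss'.
by rewrite scalerA mulVf ?scale1r //; case: (cs (s' j)).
Qed.

Lemma eq_nice_class e e' : nice_basis g e -> nice_basis g e' -> nice_equiv e e' ->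
  nice_class e = nice_class e'.
Proof.
move=> [be _ _] [be' _ _] ee'; apply/seteqP; split => e'' [ne'' ee'']; split => //.
  by apply: nice_equiv_trans ee''; apply: nice_equiv_sym.
by apply: nice_equiv_trans ee''.
Qed.

Definition basis_map e e' x : g := \sum_i coord e i x *: e'`_i.

Fact basis_map_linear e e' : linear (basis_map e e').
Proof.
move=> a x y; rewrite /basis_map scaler_sumr -big_split; apply: eq_bigr => i _.
by rewrite linearP /= scalerDl scalerA.
Qed.
HB.instance Definition _ e e' :=
  GRing.isLinear.Build K g g *:%R (basis_map e e') (basis_map_linear e e').

Lemma basis_mapE e e' i : basis_of {:g} e -> basis_map e e' e`_i = e'`_i.
Proof.
move=> be; rewrite /basis_map (bigD1 i) //= coord_free ?(basis_free be) // eqxx scale1r.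
rewrite big1 ?addr0 // => j nji.
by rewrite coord_free ?(basis_free be) // eq_sym (negbTE nji) scale0r.
Qed.

Lemma basis_mapK e e' : basis_of {:g} e -> basis_of {:g} e' ->
  cancel (basis_map e e') (basis_map e' e).
Proof.
move=> be be' x; rewrite [RHS](coord_basisE x be); apply: eq_bigr => i _.
by rewrite coord_sum_free ?(basis_free be').
Qed.

(** The linear map e_i -> e'_i respects brackets: its defect is bilinear and vanishes on basis
    vectors. *)
Lemma nice_equiv_structure_constant e e' : basis_of {:g} e -> basis_of {:g} e' ->
    (forall i j k, structure_constant e i j k = structure_constant e' i j k) ->
  nice_equiv e e'.
Proof.
move=> be be' cE; apply/nice_equivP; exists (linfun (basis_map e e')); last first.
  move=> i; exists i, 1; split; first exact: oner_neq0.
  by rewrite lfunE /= basis_mapE // scale1r.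
split.
  by exists (basis_map e' e) => x; rewrite lfunE /= basis_mapK.
move=> x y; rewrite !lfunE /=; apply/eqP; rewrite -subr_eq0; apply/eqP; move: x y.
apply: (basis_bilinear_eq0 be) => [y a u v|x a u v|i j].
- by rewrite lie_linearl !linearP /= lie_linearl scalerBr addrACA opprD.
- by rewrite lie_linearr !linearP /= lie_linearr scalerBr addrACA opprD.
apply/eqP; rewrite subr_eq0 !basis_mapE // [X in _ == X](coord_basisE _ be').
by apply/eqP/eq_bigr => k _; congr (_ *: _); apply: cE.
Qed.

Definition rescale (t : 'I_n -> K) e : n.-tuple g := [tuple t i *: e`_i | i < n].

Lemma rescaleE t e i : (rescale t e)`_i = t i *: e`_i.
Proof. by rewrite -tnth_nth tnth_mktuple. Qed.

Section Rescale.
Variables (t : 'I_n -> K) (e : n.-tuple g).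
Hypotheses (t_neq0 : forall i, t i != 0) (be : basis_of {:g} e).

Lemma rescale_basis : basis_of {:g} (rescale t e).
Proof.
rewrite basisEdim size_tuple leqnn andbT; apply: (@subv_trans _ _ <<e>>%VS).
  by rewrite (span_basis be).
apply/span_subvP => _ /tnthP[i ->]; rewrite (tnth_nth 0).
have -> : e`_i = (t i)^-1 *: (rescale t e)`_i by rewrite rescaleE scalerA mulVf ?scale1r.
exact/memvZ/memv_span/mem_basis_nth.
Qed.

Lemma coord_rescale i x : coord (rescale t e) i x = (t i)^-1 * coord e i x.
Proof.
pose k j := (t j)^-1 * coord e j x.
rewrite -[RHS]/(k i) -(coord_sum_free k i (basis_free rescale_basis)).
rewrite {1}(coord_basisE x be).
congr (coord _ _ _); apply: eq_bigr => j _.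
by rewrite rescaleE scalerA mulrAC mulVf ?mul1r.
Qed.

Lemma structure_constant_rescale i j k :
  structure_constant (rescale t e) i j k = t i * t j / t k * structure_constant e i j k.
Proof.
rewrite /structure_constant coord_rescale !rescaleE linearZl_LR linearZr_LR /= !linearZ /=.
by ring.
Qed.

Lemma nice_equiv_rescale : nice_equiv e (rescale t e).
Proof.
apply/nice_equivP; exists \1%VF.
  by split; [exists id => x; rewrite id_lfunE | move=> x y; rewrite !id_lfunE].
move=> i; exists i, (t i)^-1; split; first by rewrite invr_eq0.
by rewrite rescaleE id_lfunE scalerA mulVf ?scale1r.
Qed.

End Rescale.

Lemma nice_basis_rescale t e : (forall i, t i != 0) -> nice_basis g e ->
  nice_basis g (rescale t e).
Proof.
move=> t0 [be lie_e ip_e]; split; first exact: rescale_basis.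
  move=> i j; have [k [c eij]] := lie_e i j; exists k, (t i * t j * c / t k).
  rewrite !rescaleE linearZl_LR linearZr_LR /= eij !scalerA.
  by rewrite divfK.
move=> i j; have [h [c eij]] := ip_e i j; exists h, (t i / t j * c * t h) => y.
have {}eij : coord e j (lie e`_i y) = - (c * coord e h y).
  by rewrite -eij /interior_product /= /ce_diff_fun opprK.
rewrite /interior_product /= /ce_diff_fun !coord_rescale // rescaleE.
by rewrite linearZl_LR /= linearZ /= coord_rescale // eij; field; rewrite !t0.
Qed.

Lemma nice_lie e i j k : nice_basis g e -> structure_constant e i j k != 0 ->
  lie e`_i e`_j = structure_constant e i j k *: e`_k.
Proof.
move=> [be lie_e _]; have [h [c eij]] := lie_e i j.
rewrite /structure_constant eij linearZ /= coord_free ?(basis_free be) //.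
by have [->|_] := eqVneq h k; rewrite ?mulr1 // mulr0 eqxx.
Qed.

(** The functional on the left is, up to sign, the interior product of e_i with d e^k, a multiple of
    a single e^h. It is nonzero at e_j, so h = j. *)
Lemma nice_coord_lier e i j k x : nice_basis g e -> structure_constant e i j k != 0 ->
  coord e k (lie e`_i x) = structure_constant e i j k * coord e j x.
Proof.
move=> [be _ ip_e]; have [h [c eik]] := ip_e i k.
have {}eik y : coord e k (lie e`_i y) = - c * coord e h y.
  by rewrite mulNr -eik /interior_product /= /ce_diff_fun opprK.
rewrite /structure_constant !eik coord_free ?(basis_free be) //.
by have [->|_] := eqVneq j h; rewrite ?mulr1 // mulr0 eqxx.
Qed.

Lemma structure_constantC e i j k : structure_constant e j i k = - structure_constant e i j k.
Proof. by rewrite /structure_constant lieC linearN. Qed.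

Lemma nice_coord_liel e i j k x : nice_basis g e -> structure_constant e i j k != 0 ->
  coord e k (lie x e`_j) = structure_constant e i j k * coord e i x.
Proof.
move=> ne nz; rewrite lieC linearN /= (@nice_coord_lier _ j i) //.
  by rewrite structure_constantC mulNr opprK.
by rewrite structure_constantC oppr_eq0.
Qed.

(** * The semilinear derivation of g induced by a derivation of the scalars *)

Section Derivation.
Variable D : K -> K.
Hypothesis DD : {morph D : a b / a + b}.
Hypothesis DM : forall a b, D (a * b) = a * D b + D a * b.
Variable b : n.-tuple g.
Hypothesis bb : basis_of {:g} b.
Hypothesis Db : forall i j k, D (structure_constant b i j k) = 0.

Lemma derivation0 : D 0 = 0.
Proof. by apply: (addrI (D 0)); rewrite -DD !addr0. Qed.

Lemma derivation1 : D 1 = 0.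
Proof. by apply: (addrI (D 1)); rewrite addr0 -{3}[1]mulr1 DM mul1r mulr1. Qed.

Lemma derivationN1 : D (- 1) = 0.
Proof. by apply: (addrI (D 1)); rewrite -DD subrr derivation0 derivation1 addr0. Qed.

Definition coord_derivation x : g := \sum_i D (coord b i x) *: b`_i.
Local Notation DV := coord_derivation.

Lemma coord_coord_derivation i x : coord b i (DV x) = D (coord b i x).
Proof. by rewrite coord_sum_free ?(basis_free bb). Qed.

Lemma coord_derivationP a x y : DV (a *: x + y) = D a *: x + a *: DV x + DV y.
Proof.
apply: (coord_inj bb) => i; rewrite !linearD !linearZ /= !coord_coord_derivation.
by rewrite linearD linearZ /= DD DM [a * _ + _]addrC.
Qed.

Lemma coord_derivation_basis i : DV b`_i = 0.
Proof.
apply: (coord_inj bb) => j; rewrite coord_coord_derivation coord_free ?(basis_free bb) //.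
by rewrite linear0; case: eqP => _; rewrite ?derivation1 ?derivation0.
Qed.

(** The terms in D a cancel in the difference of the two sides, so it is bilinear; on b it vanishes
    because D kills the constants of b. *)
Lemma coord_derivation_lie x y : DV (lie x y) = lie (DV x) y + lie x (DV y).
Proof.
apply/eqP; rewrite -subr_eq0; apply/eqP; move: x y.
apply: (basis_bilinear_eq0 bb) => [y a u v|x a u v|i j].
- apply: (coord_inj bb) => k.
  rewrite lie_linearl !coord_derivationP !linearDl !linearZl_LR /=.
  by rewrite !(linearD, linearB, linearZ) /=; ring.
- apply: (coord_inj bb) => k.
  rewrite lie_linearr !coord_derivationP !linearDr !linearZr_LR /=.
  by rewrite !(linearD, linearB, linearZ) /=; ring.
rewrite !coord_derivation_basis linear0l linear0r addr0 subr0.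
apply: (coord_inj bb) => k; rewrite coord_coord_derivation linear0.
exact: Db.
Qed.

Definition diag_derivation e i : K := coord e i (DV e`_i).

(** Take the e_k coordinate of the derivation applied to [e_i, e_j] = c e_k. Niceness removes every
    off-diagonal entry of the derivation in the basis e. *)
Lemma derivation_structure_constant e i j k : nice_basis g e ->
  D (structure_constant e i j k) = structure_constant e i j k *
    (diag_derivation e i + diag_derivation e j - diag_derivation e k).
Proof.
move=> ne; have [->|nz] := eqVneq (structure_constant e i j k) 0.
  by rewrite mul0r derivation0.
have [be _ _] := ne.
have := congr1 (coord e k) (coord_derivation_lie e`_i e`_j).
rewrite (nice_lie ne nz) linearD /= (nice_coord_liel _ ne nz) (nice_coord_lier _ ne nz).
rewrite -[_ *: _]addr0 coord_derivationP.
have -> : DV 0 = 0.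
  by rewrite /coord_derivation big1 // => l _; rewrite linear0 derivation0 scale0r.
rewrite addr0 linearD !linearZ /= coord_free ?(basis_free be) // eqxx mulr1.
rewrite -!/(diag_derivation _ _) => eD.
by apply: (addIr (structure_constant e i j k * diag_derivation e k)); rewrite eD; ring.
Qed.

End Derivation.

End StructureConstants.

(** * Normalization *)

Section RowBasis.
Variables (F : fieldType) (m n : nat) (M : 'M[F]_(m, n)).

(** The selected rows are independent, so the matrix they form has a right inverse. *)
Lemma maxrankfun_solve (l : 'I_m -> F) :
  exists u : 'I_n -> F, forall r,
    \sum_a M (maxrankfun M r) a * u a = l (maxrankfun M r).
Proof.
have /row_freeP[B MB] := maxrowsub_free M.
pose w : 'cV_(\rank M) := \col_s l (maxrankfun M s).
exists (fun a => (B *m w) a 0) => r.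
have : (rowsub (maxrankfun M) M *m (B *m w)) r 0 = l (maxrankfun M r).
  by rewrite mulmxA MB mul1mx mxE.
by rewrite mxE => <-; apply: eq_bigr => a _; rewrite [in RHS]mxE.
Qed.

Lemma maxrankfun_kernel (u : 'I_n -> F) :
  (forall r, \sum_a M (maxrankfun M r) a * u a = 0) ->
  forall r, \sum_a M r a * u a = 0.
Proof.
move=> ker r.
have /submxP[X MX] : (M <= rowsub (maxrankfun M) M)%MS by rewrite eq_maxrowsub.
pose v : 'cV_n := \col_a u a.
have v0 : rowsub (maxrankfun M) M *m v = 0.
  by apply/colP => s; rewrite !mxE -[RHS](ker s); apply: eq_bigr => a _; rewrite !mxE.
have : (M *m v) r 0 = 0 by rewrite MX -mulmxA v0 mulmx0 mxE.
rewrite mxE; apply: etrans.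
by apply: eq_bigr => a _; rewrite mxE.
Qed.

End RowBasis.

Section Normalization.
Variables (R : realType) (g : lieAlgType R).
Local Notation n := (\dim {:g}).
Local Notation triple := ('I_n * 'I_n * 'I_n)%type.
Implicit Types e : n.-tuple g.

Definition structure_constants e (I : triple) : R :=
  structure_constant e I.1.1 I.1.2 I.2.

(** The exponents with which the scaling factors t act on c_ijk: it is multiplied by t_i t_j /
    t_k. *)
Definition weight (I : triple) (a : 'I_n) : R :=
  (a == I.1.1)%:R + (a == I.1.2)%:R - (a == I.2)%:R.

Lemma sum_weight I (u : 'I_n -> R) :
  \sum_a weight I a * u a = u I.1.1 + u I.1.2 - u I.2.
Proof.
have sum1 i : \sum_a (a == i)%:R * u a = u i.
  rewrite (bigD1 i) //= eqxx mul1r big1 ?addr0 // => a /negbTE ->.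
  by rewrite mul0r.
rewrite -!sum1 -big_split -sumrB; apply: eq_bigr => a _.
by rewrite /weight /= mulrBl mulrDl.
Qed.

(** Rows of vanishing constants are set to zero, so that they impose no condition. *)
Definition weight_matrix e : 'M[R]_(#|{: triple}|, n) :=
  \matrix_(r, a) ((structure_constants e (enum_val r) != 0)%:R * weight (enum_val r) a).

Lemma sum_weight_matrix e r (u : 'I_n -> R) :
  \sum_a weight_matrix e r a * u a =
    (structure_constants e (enum_val r) != 0)%:R *
      (u (enum_val r).1.1 + u (enum_val r).1.2 - u (enum_val r).2).
Proof.
by rewrite -sum_weight mulr_sumr; apply: eq_bigr => a _; rewrite mxE mulrA.
Qed.

Lemma nice_basis_normalize (b e : n.-tuple g) : basis_of {:g} b -> nice_basis g e ->
  exists e', [/\ nice_basis g e', nice_equiv e e' &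
    forall D : R -> R, {morph D : x y / x + y} ->
      (forall x y, D (x * y) = x * D y + D x * y) ->
      (forall I, D (structure_constants b I) = 0) ->
    forall I, D (structure_constants e' I) = 0].
Proof.
move=> bb ne; have [be _ _] := ne.
pose M := weight_matrix e.
(* Taking logarithms turns the conditions |c| = 1 on the selected constants into a solvable linear
   system for u = ln t. *)
have [u uE] := maxrankfun_solve M
  (fun r => - ln `|structure_constants e (enum_val r)|).
pose t a := expR (u a).
have t_neq0 a : t a != 0 by rewrite gt_eqF ?expR_gt0.
pose e' := rescale t e.
have cE I : structure_constants e' I =
    expR (u I.1.1 + u I.1.2 - u I.2) * structure_constants e I.
  by rewrite expRD expRD expRN; apply: structure_constant_rescale.
have c_eq0 I : (structure_constants e' I == 0) = (structure_constants e I == 0).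
  by rewrite cE mulf_eq0 gt_eqF ?expR_gt0.
have ne' : nice_basis g e' by apply: nice_basis_rescale.
exists e'; split => // [|D DD DM Db I]; first exact: nice_equiv_rescale.
have Dc J := derivation_structure_constant DD DM bb (fun i j k => Db (i, j, k))
  J.1.1 J.1.2 J.2 ne'.
set z := diag_derivation D b e' in Dc.
(* It is enough to treat the selected rows, whose constants are 1 or -1 and hence killed by D. *)
have Mz : forall r, \sum_a M r a * z a = 0.
  apply: maxrankfun_kernel => r; set s := maxrankfun M r.
  rewrite sum_weight_matrix.
  have [_|nz] := eqVneq (structure_constants e (enum_val s)) 0; first by rewrite mul0r.
  have Dc0 : D (structure_constants e' (enum_val s)) = 0.
    have : `|structure_constants e' (enum_val s)| = 1.
      rewrite cE normrM (gtr0_norm (expR_gt0 _)).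
      have := uE r; rewrite sum_weight_matrix nz mul1r => ->.
      by rewrite expRN lnK ?mulVf ?normr_eq0 // posrE normr_gt0.
    move/eqP; rewrite eqr_norml ler01 andbT => /orP[] /eqP ->.
      exact: derivation1.
    exact: derivationN1.
  move: Dc0; rewrite Dc => /eqP; rewrite mulf_eq0 => /orP[|/eqP ->].
    by move: nz; rewrite -c_eq0 => /negbTE ->.
  by rewrite mulr0.
have := Mz (enum_rank I); rewrite sum_weight_matrix enum_rankK => /eqP.
rewrite Dc mulf_eq0 => /orP[|/eqP ->]; last by rewrite mulr0.
rewrite pnatr_eq0 eqb0 negbK -c_eq0 => /eqP.
by rewrite /structure_constants => ->; rewrite mul0r.
Qed.

Lemma countable_nice_constants : exists2 N : set R, countable N &
  forall e, nice_basis g e -> exists e',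
    [/\ nice_basis g e', nice_equiv e e' & forall I, N (structure_constants e' I)].
Proof.
pose b : n.-tuple g := vbasis {:g}.
have bb : basis_of {:g} b by apply: vbasisP.
have [A [phi phiP]] := countable_subring_containing
  [seq structure_constants b J | J <- enum {: triple}].
exists (algebraic_values phi); first exact: countable_algebraic_values.
move=> e ne; have [e' [ne' ee' De']] := nice_basis_normalize bb ne.
exists e'; split => // I; apply: derivation_separates => D DD DM Dphi.
apply: (De' D DD DM) => J.
have [|a <-] := phiP (structure_constants b J); last exact: Dphi.
by apply: map_f; rewrite mem_enum.
Qed.

End Normalization.

(** * Counting the equivalence classes *)

Lemma countable_image_invariant (T U : Type) (J : countType) (P : set T) (f : T -> U)
    (key : T -> J) :
    (forall x y, P x -> P y -> key x = key y -> f x = f y) ->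
  countable (f @` P).
Proof.
move=> keyP; apply/countable_injP.
(* A point of the image is numbered by the key of one chosen preimage; the value 0 off the image is
   a default. *)
have /choice[h hP] y : exists m, (f @` P) y ->
    exists x, [/\ P x, f x = y & pickle (key x) = m].
  case: (pselect ((f @` P) y)) => [[x Px fx]|ny]; last by exists 0%N.
  by exists (pickle (key x)) => _; exists x.
exists h => y1 y2 /set_mem/hP[x1 [P1 <- <-]] /set_mem/hP[x2 [P2 <- <-]].
by move=> /(pcan_inj pickleK); apply: keyP.
Qed.

Theorem corollary3p7 (R : realType) (g : lieAlgType R) (hnil : nilpotent_lie g) :
  countable [set nice_class e | e in [set e | nice_basis g e]]%classic.
Proof.
have [N /countable_injP[num numN] normal] := countable_nice_constants g.
have /choice[nf nfP] e : exists e', nice_basis g e ->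
    [/\ nice_basis g e', nice_equiv e e' & forall I, N (structure_constants e' I)].
  case: (pselect (nice_basis g e)) => [/normal[e' e'P]|?]; [by exists e' | by exists e].
(* A normalized basis is recorded by the numbers, under an injection of N into the naturals, of its
   finitely many structure constants. *)
pose key e := [ffun I => num (structure_constants (nf e) I)].
apply: (@countable_image_invariant _ _ _ _ _ key).
move=> e1 e2 n1 n2 /ffunP keyE.
have [n1' e1' N1] := nfP _ n1; have [n2' e2' N2] := nfP _ n2.
rewrite (eq_nice_class n1 n1' e1') (eq_nice_class n2 n2' e2').
apply: eq_nice_class => //; case: (n1') => b1 _ _; case: (n2') => b2 _ _.
apply: nice_equiv_structure_constant => // i j k.
have := keyE (i, j, k); rewrite !ffunE => /numN; apply; apply/mem_set; [apply: N1|apply: N2].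
Qed.
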